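(* Let $n \geq 2$ and $k \geq 1$ be integers. Then $$(-1)^{n-1} m_{n,1^k} = \sum_{a=1}^n \left(k+1 + \sum_{i=1}^{a-1} q^{n-i}\right) \sum_{\tau \models n-a} \; \sum_{b=0}^k \; \sum_{\rho \models k-b} C_\tau\, C_{a+b}\, C_{\rho}\, 1,$$ where $m_{n,1^k}$ is the monomial symmetric function indexed by the hook partition $(n,1,\dots,1)$ with $k$ ones.
   Context: Work in the ring of symmetric functions in $X = x_1+x_2+\cdots$ with coefficients in $\mathbb{Q}(q)$. $h_m$ denotes the complete homogeneous symmetric functions, and $P[\,\cdot\,]$ denotes plethystic substitution (so $p_r\left[X - \frac{1-1/q}{z}\right] = p_r[X] - \frac{1-q^{-r}}{z^r}$ for power sums $p_r$, extended to all symmetric functions as an algebra homomorphism). For a non-negative integer $a$, the linear operator $C_a$ on symmetric functions is defined by $$C_a P[X] = \left(-\frac{1}{q}\right)^{a-1} P\left[X - \frac{1-1/q}{z}\right] \sum_{m\ge 0} z^m h_m[X] \;\Big|_{z^a},$$ where $f|_{z^a}$ denotes the coefficient of $z^a$ in $f$ expanded as a formal series in $z$. The notation $\alpha \models N$ means that $\alpha=(\alpha_1,\dots,\alpha_\ell)$ is a composition of $N$ (a finite sequence of positive integers with sum $N$; for $N=0$ there is exactly one, the empty composition). For a composition $\alpha=(\alpha_1,\dots,\alpha_\ell)$, $C_\alpha = C_{\alpha_1}\circ\cdots\circ C_{\alpha_\ell}$ (the identity operator if $\alpha$ is empty). The expression $C_\tau C_{a+b} C_\rho 1$ is the composite operator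 applied to the constant symmetric function $1$. *)

(* Defs.v *)
From HB Require Import structures.
From mathcomp Require Import all_boot all_order all_algebra.
From mathcomp Require Import boolp.

Set Implicit Arguments.
Unset Strict Implicit.
Unset Printing Implicit Defensive.

Import GRing.Theory.
Local Open Scope ring_scope.

(* A sequence s = [:: s_1; ...; s_l] stands for the monomial
   x_1^s_1 ... x_l^s_l in the variables x_1, x_2, ..., and a formal power
   series is given by its coefficients seq nat -> R.  A symmetric function is
   a power series of bounded degree whose coefficients are invariant under
   permutations of the variables; coefficients must also agree on a sequence
   and on its padding by a zero exponent, which denote the same monomial. *)

Definition is_symfun (R : nzRingType) (f : seq nat -> R) : Prop :=
  [/\ forall s t, perm_eq s t -> f s = f t,
      forall s, f (rcons s 0%N) = f s
    & exists d : nat, forall s, (d < sumn s)%N -> f s = 0].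

Record symfun (R : nzRingType) :=
  SymFun { sfcoef :> seq nat -> R; symfunP : is_symfun sfcoef }.

(* Cauchy product of power series, expanding the exponent of the first variable
   first: the coefficient of s is the sum of f u * g v over u + v = s. *)
Fixpoint series_mul (R : nzRingType) (f g : seq nat -> R) (s : seq nat) : R :=
  if s is a :: s' then
    \sum_(i < a.+1) series_mul (fun u => f (val i :: u))
                               (fun v => g ((a - i)%N :: v)) s'
  else f [::] * g [::].

Section SeriesMul.
Variable R : comNzRingType.
Implicit Types (f g h : seq nat -> R) (s t : seq nat).

Lemma series_mulC f g s : series_mul f g s = series_mul g f s.
Proof.
elim: s f g => [|a s IH] f g /=; first by rewrite mulrC.
rewrite (reindex_inj rev_ord_inj) /=; apply: eq_bigr => i _.
by rewrite IH subSS subKn // -ltnS.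
Qed.

Lemma eq_series_mul f f' g g' s :
  f =1 f' -> g =1 g' -> series_mul f g s = series_mul f' g' s.
Proof. by move=> /funext-> /funext->. Qed.

Lemma series_mul_suml (I : Type) (r : seq I) (P : pred I)
    (F : I -> seq nat -> R) g s :
  series_mul (fun u => \sum_(i <- r | P i) F i u) g s =
  \sum_(i <- r | P i) series_mul (F i) g s.
Proof.
elim: s F g => [|a s IH] F g /=; first by rewrite mulr_suml.
by under eq_bigr do rewrite IH; rewrite exchange_big.
Qed.

Lemma series_mul_sumr (I : Type) (r : seq I) (P : pred I)
    (F : I -> seq nat -> R) g s :
  series_mul g (fun u => \sum_(i <- r | P i) F i u) s =
  \sum_(i <- r | P i) series_mul g (F i) s.
Proof.
by rewrite series_mulC series_mul_suml; under eq_bigr do rewrite series_mulC.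
Qed.

Lemma series_mulDl f g h s :
  series_mul (fun u => f u + g u) h s = series_mul f h s + series_mul g h s.
Proof.
elim: s f g h => [|a s IH] f g h /=; first by rewrite mulrDl.
by under eq_bigr do rewrite IH; rewrite big_split.
Qed.

Lemma series_mulZl c f g s :
  series_mul (fun u => c * f u) g s = c * series_mul f g s.
Proof.
elim: s f g => [|a s IH] f g /=; first by rewrite mulrA.
by rewrite mulr_sumr; apply: eq_bigr => i _; rewrite IH.
Qed.

Lemma series_mulA f g h s :
  series_mul f (series_mul g h) s = series_mul (series_mul f g) h s.
Proof.
elim: s f g h => [|i s IH] f g h /=; first by rewrite mulrA.
pose D j (f : seq nat -> R) := fun u => f (j :: u).
pose coef3 j k := series_mul (D j f)
  (series_mul (D (i - j - k)%N g) (D k h)) s.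
transitivity (\sum_(j < i.+1) \sum_(k < i.+1 | (k <= i - j)%N) coef3 j k).
  apply: eq_bigr => /= j _; rewrite series_mul_sumr /=.
  rewrite (reindex_inj rev_ord_inj) /=.
  rewrite (big_ord_narrow_leq (leq_subr _ _)); apply: eq_bigr => k _ /=.
  by rewrite /coef3 subSS subKn // -ltnS.
rewrite (exchange_big_dep predT) //=.
rewrite [RHS](reindex_inj rev_ord_inj) /=; apply: eq_bigr => k _.
rewrite subSS subKn -1?ltnS //.
transitivity (\sum_(j < i.+1 | (j <= i - k)%N) coef3 j k).
  apply: eq_bigl => j; rewrite -ltnS -(ltnS j) -!subSn ?leq_ord //.
  by rewrite -subn_gt0 -(subn_gt0 j) -!subnDA addnC.
rewrite (big_ord_narrow_leq (leq_subr _ _)) series_mul_suml /=.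
by apply: eq_bigr => j _; rewrite /coef3 -!subnDA addnC subnDA IH.
Qed.

Definition series_one (s : seq nat) : R := (all (eq_op^~ 0%N) s)%:R.

Lemma series_mul1 f s : series_mul series_one f s = f s.
Proof.
elim: s f => [|a s IH] f /=; first by rewrite mul1r.
rewrite big_ord_recl /= big1 ?addr0 => [|i _].
  by rewrite subn0; exact: IH.
rewrite (eq_series_mul (f' := fun u => 0 * f u) (g' := fun v => f (a - (lift ord0 i) :: v)%N)) //.
  by rewrite series_mulZl mul0r.
by move=> u; rewrite mul0r.
Qed.

Lemma series_mul_eq0 f g s :
    (forall u v, (sumn u + sumn v = sumn s)%N -> f u * g v = 0) ->
  series_mul f g s = 0.
Proof.
elim: s f g => [|a s IH] f g H /=; first exact: H.
apply: big1 => i _; apply: IH => u v uv; apply: H => /=.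
by rewrite addnACA uv subnKC // -ltnS.
Qed.

Lemma series_mul_rcons0 f g s :
    (forall u, f (rcons u 0%N) = f u) -> (forall u, g (rcons u 0%N) = g u) ->
  series_mul f g (rcons s 0%N) = series_mul f g s.
Proof.
elim: s f g => [|a s IH] f g Hf Hg /=.
  by rewrite big_ord1 /= (Hf [::]) (Hg [::]).
by apply: eq_bigr => i _; rewrite IH // => u; rewrite -rcons_cons.
Qed.

Lemma series_mul_perm f g s t :
    (forall u v, perm_eq u v -> f u = f v) ->
    (forall u v, perm_eq u v -> g u = g v) ->
  perm_eq s t -> series_mul f g s = series_mul f g t.
Proof.
have symD h j : (forall u v, perm_eq u v -> h u = h v :> R) ->
    forall u v, perm_eq u v -> h (j :: u) = h (j :: v).
  by move=> H u v uv; apply: H; rewrite perm_cons.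
have mid a t1 : forall t2 f g, (forall u v, perm_eq u v -> f u = f v) ->
    (forall u v, perm_eq u v -> g u = g v) ->
    series_mul f g (t1 ++ a :: t2) = series_mul f g (a :: t1 ++ t2).
  elim: t1 => [//|b t1 IH] t2 {}f {}g Hf Hg.
  rewrite [LHS]/=; under eq_bigr do rewrite (IH _ _ _ (symD _ _ Hf) (symD _ _ Hg)).
  rewrite /= exchange_big /=; apply: eq_bigr => i _; apply: eq_bigr => j _.
  apply: eq_series_mul => u; [apply: Hf | apply: Hg];
    exact: (permEl (perm_catCA [:: _] [:: _] u)).
move=> Hf Hg; elim: s t f g Hf Hg => [|a s IH] t f' g' Hf Hg st.
  by move: st; rewrite perm_sym => /perm_nilP->.
have at_ : a \in t by rewrite -(perm_mem st) mem_head.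
case/splitPr: at_ st => t1 t2 st; rewrite mid //=.
apply: eq_bigr => i _; apply: IH; do ?exact: symD.
rewrite -(perm_cons a) (perm_trans st) //.
exact: (permEl (perm_catCA t1 [:: a] t2)).
Qed.

Lemma is_symfun_mul (f g : symfun R) : is_symfun (series_mul f g).
Proof.
case: f g => f [f1 f2 [d f3]] [g [g1 g2 [e g3]]]; split=> [s t|s|].
- exact: series_mul_perm.
- exact: series_mul_rcons0.
exists (d + e)%N => s des; apply: series_mul_eq0 => u v uv /=.
have [ud|ud] := ltnP d (sumn u); first by rewrite f3 ?mul0r.
have [ve|ve] := ltnP e (sumn v); first by rewrite (g3 v) ?mulr0.
by move: des; rewrite -uv ltnNge leq_add.
Qed.

End SeriesMul.

Section SymFun.
Variable R : comNzRingType.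
Local Notation Lambda := (symfun R).
Implicit Types f g : Lambda.

HB.instance Definition _ := gen_eqMixin Lambda.
HB.instance Definition _ := gen_choiceMixin Lambda.

Lemma symfun_eq f g : (forall s, f s = g s) -> f = g.
Proof.
case: f g => [f Hf] [g Hg] /= /funext fg; case: _ / fg Hg => Hg.
by congr SymFun; exact: Prop_irrelevance.
Qed.

Lemma is_symfun0 : is_symfun (fun=> 0 : R).
Proof. by split=> //; exists 0%N. Qed.

Lemma is_symfunN f : is_symfun (fun s => - f s).
Proof.
case: f => f [f1 f2 [d f3]]; split=> [s t /f1 st|s|] /=.
- by rewrite st.
- by rewrite f2.
by exists d => s /f3->; rewrite oppr0.
Qed.

Lemma is_symfunD f g : is_symfun (fun s => f s + g s).
Proof.
case: f g => f [f1 f2 [d f3]] [g [g1 g2 [e g3]]]; split=> [s t st|s|] /=.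
- by rewrite (f1 _ _ st) (g1 _ _ st).
- by rewrite f2 g2.
exists (maxn d e) => s; rewrite gtn_max => /andP[ds es].
by rewrite f3 // g3 // addr0.
Qed.

Lemma is_symfunZ (c : R) f : is_symfun (fun s => c * f s).
Proof.
case: f => f [f1 f2 [d f3]]; split=> [s t /f1 st|s|] /=.
- by rewrite st.
- by rewrite f2.
by exists d => s /f3->; rewrite mulr0.
Qed.

Lemma is_symfun1 : is_symfun (@series_one R).
Proof.
split=> [s t st|s|]; rewrite /series_one.
- by rewrite (perm_all _ st).
- by rewrite all_rcons.
exists 0%N => s; elim: s => //= a s IH.
by case: a => //=; rewrite add0n.
Qed.

Definition sf_zero : Lambda := SymFun is_symfun0.
Definition sf_opp f : Lambda := SymFun (is_symfunN f).
Definition sf_add f g : Lambda := SymFun (is_symfunD f g).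
Definition sf_one : Lambda := SymFun is_symfun1.
Definition sf_mul f g : Lambda := SymFun (is_symfun_mul f g).
Definition sf_scale (c : R) f : Lambda := SymFun (is_symfunZ c f).

Fact sf_addA : associative sf_add.
Proof. by move=> f g h; apply: symfun_eq => s /=; rewrite addrA. Qed.
Fact sf_addC : commutative sf_add.
Proof. by move=> f g; apply: symfun_eq => s /=; rewrite addrC. Qed.
Fact sf_add0 : left_id sf_zero sf_add.
Proof. by move=> f; apply: symfun_eq => s /=; rewrite add0r. Qed.
Fact sf_addN : left_inverse sf_zero sf_opp sf_add.
Proof. by move=> f; apply: symfun_eq => s /=; rewrite addNr. Qed.
HB.instance Definition _ :=
  GRing.isZmodule.Build Lambda sf_addA sf_addC sf_add0 sf_addN.

Fact sf_mulA : associative sf_mul.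
Proof. by move=> f g h; apply: symfun_eq => s; exact: series_mulA. Qed.
Fact sf_mulC : commutative sf_mul.
Proof. by move=> f g; apply: symfun_eq => s; exact: series_mulC. Qed.
Fact sf_mul1 : left_id sf_one sf_mul.
Proof. by move=> f; apply: symfun_eq => s; exact: series_mul1. Qed.
Fact sf_mulD : left_distributive sf_mul sf_add.
Proof. by move=> f g h; apply: symfun_eq => s; exact: series_mulDl. Qed.
Fact sf_one_neq0 : sf_one != 0.
Proof.
by apply/eqP => /(congr1 (fun f : Lambda => f [::])) /eqP; rewrite oner_eq0.
Qed.
HB.instance Definition _ := GRing.Zmodule_isComNzRing.Build Lambda
  sf_mulA sf_mulC sf_mul1 sf_mulD sf_one_neq0.

Fact sf_scaleA a b f : sf_scale a (sf_scale b f) = sf_scale (a * b) f.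
Proof. by apply: symfun_eq => s /=; rewrite mulrA. Qed.
Fact sf_scale1 : left_id 1 sf_scale.
Proof. by move=> f; apply: symfun_eq => s /=; rewrite mul1r. Qed.
Fact sf_scaleDr : right_distributive sf_scale +%R.
Proof. by move=> c f g; apply: symfun_eq => s /=; rewrite mulrDr. Qed.
Fact sf_scaleDl f : {morph sf_scale^~ f : a b / a + b}.
Proof. by move=> a b; apply: symfun_eq => s /=; rewrite mulrDl. Qed.
HB.instance Definition _ := GRing.Zmodule_isLmodule.Build R Lambda
  sf_scaleA sf_scale1 sf_scaleDr sf_scaleDl.

Fact sf_scaleAl (c : R) f g : c *: (f * g) = (c *: f) * g.
Proof. by apply: symfun_eq => s /=; rewrite series_mulZl. Qed.
HB.instance Definition _ := GRing.Lmodule_isLalgebra.Build R Lambda sf_scaleAl.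
HB.instance Definition _ := GRing.Lalgebra_isComAlgebra.Build R Lambda.

Lemma sf_coef0 s : (0 : Lambda) s = 0. Proof. by []. Qed.
Lemma sf_coef1 s : (1 : Lambda) s = (all (eq_op^~ 0%N) s)%:R.
Proof. by []. Qed.
Lemma sf_coefD f g s : (f + g) s = f s + g s. Proof. by []. Qed.
Lemma sf_coefN f s : (- f) s = - f s. Proof. by []. Qed.
Lemma sf_coefZ c f s : (c *: f) s = c * f s. Proof. by []. Qed.
Lemma sf_coefM f g s : (f * g) s = series_mul f g s. Proof. by []. Qed.
Lemma sf_coef_sum (I : Type) (r : seq I) (P : pred I) (F : I -> Lambda) s :
  (\sum_(i <- r | P i) F i) s = \sum_(i <- r | P i) F i s.
Proof. by apply: (big_morph (fun f : Lambda => f s)). Qed.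

(* Used with lam a partition, i.e. a sequence of positive integers (in any
   order). *)
Lemma is_symfun_mono (lam : seq nat) : is_symfun
  (fun s => (perm_eq [seq i <- s | 0 < i] lam)%N%:R : R).
Proof.
split=> [s t st|s|].
- by have /permPl-> := perm_filter (fun i => 0 < i)%N st.
- by rewrite filter_rcons.
exists (sumn lam) => s; case: (boolP (perm_eq _ _)) => // /perm_sumn <-.
have -> : sumn [seq i <- s | (0 < i)%N] = sumn s; last by rewrite ltnn.
by elim: s => //= -[|a] s /= ->.
Qed.

Definition sf_mono lam : Lambda := SymFun (is_symfun_mono lam).

Definition sf_powersum (r : nat) : Lambda := sf_mono [:: r].

Lemma is_symfun_h (m : nat) : is_symfun (fun s => (sumn s == m)%:R : R).
Proof.
split=> [s t /perm_sumn->|s|] //; first by rewrite sumn_rcons addn0.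
by exists m => s ms; rewrite gtn_eqF.
Qed.

Definition sf_complete m : Lambda := SymFun (is_symfun_h m).

End SymFun.

Notation "''m_' lam" := (sf_mono _ lam)
  (at level 8, lam at level 2, format "''m_' lam").
Notation "''p_' r" := (sf_powersum _ r)
  (at level 8, r at level 2, format "''p_' r").
Notation "''h_' m" := (sf_complete _ m)
  (at level 8, m at level 2, format "''h_' m").

Section AddVariable.
Variable R : comNzRingType.
Local Notation Lambda := (symfun R).
Implicit Types (f g : Lambda) (F G : {poly Lambda}).

Lemma is_symfun_cons f j : is_symfun (fun s => f (j :: s)).
Proof.
case: f => f [f1 f2 [d f3]]; split=> [s t st|s|] /=.
- by apply: f1; rewrite perm_cons.
- by rewrite -rcons_cons.
by exists d => s ds; apply: f3; rewrite /= ltn_addl.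
Qed.

Definition sf_cons j f : Lambda := SymFun (is_symfun_cons f j).

Lemma sf_deg f : {d : nat | forall s, (d < sumn s)%N -> f s = 0}.
Proof. by apply: cid; case: f => f []. Qed.

(* f[X + c w] as a polynomial in w *)
Definition sf_addvar (c : R) f : {poly Lambda} :=
  \poly_(j < (sval (sf_deg f)).+1) (c ^+ j *: sf_cons j f).

Lemma coef_addvar c f j : (sf_addvar c f)`_j = c ^+ j *: sf_cons j f.
Proof.
rewrite coef_poly; case: ltnP => // ltdj; case: sf_deg ltdj => /= d Hd ltdj.
apply: symfun_eq => s /=; rewrite Hd ?mulr0 //=.
by rewrite (leq_trans ltdj) ?leq_addr.
Qed.

Lemma sf_cons0 f : sf_cons 0 f = f.
Proof.
apply: symfun_eq => s /=; case: f => f [f1 f2 _] /=.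
by rewrite -[RHS]f2; apply: f1; rewrite perm_sym; exact: (permEl (perm_rcons 0%N s)).
Qed.

Fact sf_addvar_zmod c : zmod_morphism (sf_addvar c).
Proof.
move=> f g; apply/polyP => j; rewrite coefB !coef_addvar -scalerBr.
by congr (_ *: _); apply: symfun_eq.
Qed.

Fact sf_addvar_monoid c : monoid_morphism (sf_addvar c).
Proof.
split=> [|f g]; apply/polyP => j.
  rewrite coef_addvar coef1; case: j => [|j] /=.
    by rewrite expr0 scale1r sf_cons0.
  by apply: symfun_eq => s /=; rewrite mulr0.
rewrite coefM coef_addvar.
have -> : sf_cons j (f * g) = \sum_(i < j.+1) sf_cons i f * sf_cons (j - i) g.
  by apply: symfun_eq => s; rewrite sf_coef_sum.
rewrite scaler_sumr; apply: eq_bigr => i _.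
by rewrite !coef_addvar -scalerAl -scalerAr scalerA -exprD subnKC // -ltnS.
Qed.

HB.instance Definition _ c :=
  GRing.isZmodMorphism.Build _ _ (sf_addvar c) (sf_addvar_zmod c).
HB.instance Definition _ c :=
  GRing.isMonoidMorphism.Build _ _ (sf_addvar c) (sf_addvar_monoid c).

Lemma sf_addvarC c a : sf_addvar c a%:A = (a%:A)%:P.
Proof.
apply/polyP => j; rewrite coef_addvar coefC; case: j => [|j] /=.
  by rewrite expr0 scale1r sf_cons0.
by apply: symfun_eq => s; rewrite /= /series_one /= !mulr0.
Qed.

Lemma sf_addvar_p c r : (0 < r)%N ->
  sf_addvar c 'p_r = ('p_r)%:P + (c ^+ r)%:A *: 'X^r.
Proof.
move=> r0; apply/polyP => j.
rewrite coef_addvar coefD coefC coefZ coefXn; case: j => [|j] /=.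
  by rewrite expr0 scale1r sf_cons0 ltn_eqF // mulr0 addr0.
rewrite add0r; case: eqP => [<-|/eqP neq]; last first.
  rewrite mulr0; apply: symfun_eq => s /=; case: (boolP (perm_eq _ _)).
    case: filter => [|b u] H; last by have := perm_size H.
    by have := perm_mem H r; rewrite !inE eqxx eq_sym (negPf neq).
  by rewrite mulr0.
rewrite mulr1; congr (_ *: _); apply: symfun_eq => s.
rewrite /= /series_one; congr (_%:R); congr nat_of_bool.
have -> : all (eq_op^~ 0%N) s = ([seq i <- s | (0 < i)%N] == [::]).
  by elim: s => //= -[|a] s IH.
case: filter => [|b u]; first by rewrite perm_refl.
by apply/negP => /perm_size.
Qed.

Fact addvar_comm : commr_rmorph (sf_addvar 1) 'X.
Proof. by move=> f; exact: mulrC. Qed.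

Local Notation shift := (horner_morph addvar_comm).

Lemma coef_shift F n : (shift F)`_n = \sum_(i < n.+1) sf_cons (n - i) F`_i.
Proof.
have shiftE m : (size F <= m)%N ->
    shift F = \sum_(i < m) sf_addvar 1 F`_i * 'X^i.
  move=> Fm; rewrite /horner_morph (horner_coef_wide _ (n := m)); last first.
    by rewrite (leq_trans (size_poly _ _)).
  by apply: eq_bigr => i _; rewrite coef_map.
rewrite (shiftE (size F + n.+1)%N) ?leq_addr // coef_sum.
rewrite (big_ord_widen (size F + n.+1) (fun i => sf_cons (n - i) F`_i)) ?leq_addl //.
rewrite [RHS]big_mkcond /=; apply: eq_bigr => i _.
rewrite coefMXn ltnS ltnNge; case: leqP => //= _.
by rewrite coef_addvar expr1n scale1r.
Qed.

Lemma shift_inj : injective shift.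
Proof.
apply: raddf_inj => F F0; apply/polyP => n; rewrite coef0.
elim/ltn_ind: n => n IH; have := coef_shift F n.
rewrite F0 coef0 big_ord_recr /= subnn sf_cons0 big1 ?add0r // => i _.
by rewrite IH //; apply: symfun_eq.
Qed.

Lemma shift_onto F : exists G, shift G = F.
Proof.
have onC d f : (forall s, (d <= sumn s)%N -> f s = 0) ->
    exists G, shift G = f%:P.
  elim/ltn_ind: d f => d IH f fd.
  have H (j : nat) : exists G, shift G = (sf_cons j.+1 f)%:P.
    case: d IH fd => [|d] IH fd.
      exists 0; rewrite rmorph0; have -> : sf_cons j.+1 f = 0.
        by apply: symfun_eq => s; exact: fd.
      by rewrite polyC0.
    apply: (IH d) => // s ds; apply: fd; rewrite /= addSn ltnS.
    by rewrite (leq_trans ds) ?leq_addl.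
  pose G j := sval (cid (H j)).
  have GE j : shift (G j) = (sf_cons j.+1 f)%:P by rewrite /G; case: cid.
  have [e fe] := sf_deg f.
  exists (f%:P - \sum_(j < e) G j * 'X^(j.+1)).
  rewrite raddfB /= horner_morphC raddf_sum /=.
  under eq_bigr do rewrite rmorphM rmorphXn /= horner_morphX GE.
  apply/polyP => n; rewrite coefB coef_addvar expr1n scale1r coef_sum coefC.
  under eq_bigr do rewrite coefCM coefXn.
  case: n => [|n] /=.
    by rewrite big1 ?subr0 ?sf_cons0 // => i _; rewrite mulr0.
  have [en|ne] := leqP e n.
    rewrite big1 ?subr0 => [|i _].
      apply: symfun_eq => s; apply: fe => /=.
      by rewrite addSn ltnS (leq_trans en) ?leq_addr.
    by rewrite eqSS gtn_eqF ?mulr0 // (leq_trans (ltn_ord i)).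
  rewrite (bigD1 (Ordinal ne)) //= eqxx mulr1 big1 ?addr0 ?subrr // => i.
  by rewrite -val_eqE /= eqSS eq_sym => /negPf->; rewrite mulr0.
elim/poly_ind: F => [|F f [G <-]]; first by exists 0; rewrite rmorph0.
have [d fd] := sf_deg f; have [|G' <-] := onC d.+1 f; first exact: fd.
by exists (G * 'X + G'); rewrite rmorphD rmorphM /= horner_morphX.
Qed.

Lemma pleth_exists (c : R) :
  exists phi : {rmorphism Lambda -> {poly Lambda}},
    (forall a : R, phi a%:A = (a%:A)%:P) /\
    (forall r, (0 < r)%N ->
       phi 'p_r = ('p_r)%:P - (1 - c ^+ r)%:A *: 'X^r).
Proof.
pose g F := sval (cid (shift_onto F)).
have gK : cancel g shift by move=> F; rewrite /g; case: cid.
have Kg : cancel shift g by move=> F; apply: shift_inj; rewrite gK.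
have gZ : zmod_morphism g := can2_zmod_morphism Kg gK.
have gM : monoid_morphism g := can2_monoid_morphism Kg gK.
pose gzm := GRing.isZmodMorphism.Build _ _ g gZ.
pose gmm := GRing.isMonoidMorphism.Build _ _ g gM.
pose gr : {rmorphism {poly Lambda} -> {poly Lambda}} :=
  HB.pack g gzm gmm.
exists (gr \o sf_addvar c : {rmorphism _ -> _}); split=> [a|r r0] /=.
  by apply: shift_inj; rewrite gK horner_morphC /= !sf_addvarC.
apply: shift_inj; rewrite gK raddfB /= horner_morphC -mul_polyC.
rewrite rmorphM rmorphXn /= horner_morphX horner_morphC /= sf_addvarC.
rewrite !sf_addvar_p // expr1n scale1r mul_polyC !scalerBl scale1r.
by rewrite !scale1r -addrA opprB [X in _ = _ + X]addrC subrK.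
Qed.

End AddVariable.

Definition Qq : fieldType := {fraction {poly rat}}.
Definition q : Qq := FracField.tofrac 'X.
Notation Lambda := (symfun Qq).

(* In {poly Lambda} the indeterminate 'X stands for 1/z. The power sums generate
   Lambda over the field Qq of characteristic 0, so that these equations
   determine phi. *)
Definition is_pleth (phi : {rmorphism Lambda -> {poly Lambda}}) : Prop :=
  (forall c : Qq, phi c%:A = (c%:A)%:P) /\
  (forall r : nat, (0 < r)%N ->
     phi 'p_r = ('p_r)%:P - (1 - q ^- r)%:A *: 'X^r).

Lemma is_pleth_exists : exists phi, is_pleth phi.
Proof.
have [phi [phiC phip]] := pleth_exists (q^-1); exists phi; split=> // r r0.
by rewrite phip // exprVn.
Qed.

(* P |-> P[X - (1 - 1/q)/z] *)
Definition pleth : {rmorphism Lambda -> {poly Lambda}} :=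
  sval (cid is_pleth_exists).

Lemma plethP : is_pleth pleth.
Proof. exact: svalP. Qed.

(* The coefficient of z^a in (\sum_j F_j z^(-j)) (\sum_m z^m h_m) is
   \sum_j F_j h_(a+j). *)
Definition Cop (a : nat) (P : Lambda) : Lambda :=
  (- q^-1) ^ (a%:Z - 1) *:
    \sum_(j < size (pleth P)) (pleth P)`_j * 'h_(a + j).

Definition Ccomp (alpha : seq nat) (P : Lambda) : Lambda := foldr Cop P alpha.

Fixpoint compositions_rec (fuel n : nat) : seq (seq nat) :=
  if n is 0 then [:: [::]] else
  if fuel is f.+1 then
    [seq a :: t | a <- iota 1 n, t <- compositions_rec f (n - a)]
  else [::].

Definition compositions (n : nat) : seq (seq nat) := compositions_rec n n.

Lemma mem_compositions n s :
  (s \in compositions n) = all (ltn 0) s && (sumn s == n).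
Proof.
have rec f : forall m u, (m <= f)%N ->
    (u \in compositions_rec f m) = all (ltn 0) u && (sumn u == m).
  elim: f => [|f IH] [|m] u mf //; try by case: u => [|[|b] u] //=; rewrite andbF.
  change (compositions_rec f.+1 m.+1) with
    [seq a :: t | a <- iota 1 m.+1, t <- compositions_rec f (m.+1 - a)].
  apply/allpairsPdep/idP => [[a [t [+ + ->]]]|].
    rewrite mem_iota => /andP[a0 am]; rewrite IH; last first.
      by rewrite leq_subLR (leq_trans mf) // -add1n leq_add.
    by case/andP=> /= -> /eqP ->; rewrite a0 /= subnKC.
  case: u => [//|a t] /andP[/andP[a0 t0] /eqP mE].
  have {}a0 : (0 < a)%N by [].
  have {}mE : (a + sumn t)%N = m.+1 by [].
  have tE : (m.+1 - a)%N = sumn t by rewrite -mE addKn.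
  exists a, t; split=> //; first by rewrite mem_iota a0 add1n ltnS -mE leq_addr /=.
  have tf : (m.+1 - a <= f)%N.
    by rewrite leq_subLR (leq_trans mf) // -add1n leq_add.
  by rewrite (IH _ _ tf) tE eqxx andbT.
exact: rec.
Qed.

Lemma compositions_uniq n : uniq (compositions n).
Proof.
rewrite /compositions; move: {1}n => f; elim: f n => [|f IH] [|n] //.
change (compositions_rec f.+1 n.+1) with
  [seq a :: t | a <- iota 1 n.+1, t <- compositions_rec f (n.+1 - a)].
apply: allpairs_uniq_dep => [|a _|[a t] [b u] _ _ /= [-> ->]] //.
exact: iota_uniq.
Qed.

(* Main.v *)
From HB Require Import structures.
Require Import Defs.
From mathcomp Require Import all_boot all_order all_algebra.
From mathcomp Require Import ring zify.

Set Implicit Arguments.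
Unset Strict Implicit.
Unset Printing Implicit Defensive.

Import GRing.Theory.
Local Open Scope ring_scope.

(** Put u = 1/q.  For a > 0 the operator C_a sends P to (-u)^(a-1) times the
    coefficient of z^a in P[X - (1 - u)/z] * sum_m z^m h_m.

    Let A_N be the sum of C_tau over all compositions tau of N.  Splitting off
    the first part of tau gives A_N = sum_c C_c A_(N-c), so a sequence with
    G_n = b_n + sum_(1 <= c < n) C_c G_(n-c) is G_n = sum_a A_(n-a) b_a
    ([compsum_solve]).  The nested sums over compositions are therefore
    evaluated by guessing G and checking a one-step recurrence.

    The innermost sums collapse: A_m 1 = e_m, and
    B_a := sum_b C_(a+b) e_(k-b) = (-u)^(a-1) s_(a,1^k), a hook Schur function
    ([sum_Cop_e], [sum_compsum_1]).  Since q^(n-i) = q^n u^i, the theorem is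
    k+1 times the first of the following expansions plus q^n times the second:
    - e_(n+k) = sum_a A_(n-a) B_a ([elementary_expansion]): cut a composition
      of n+k at the part containing position n;
    - u^n ((-1)^(n-1) m_(n,1^k) - (k+1) e_(n+k))
        = sum_a (u + ... + u^(a-1)) A_(n-a) B_a ([mhook_corr_expansion]).

    The recurrence of the second expansion has to start at n = 1, where the
    right-hand side vanishes.  In it, m_(n,1^k) is therefore replaced by
    m(n,k) = sum_i x_i^n e_k(other variables), which is m_(n,1^k) for n > 1 but
    (k+1) e_(k+1) for n = 1, so that the left-hand side vanishes too.
    The substitution is explicit on m(n,k) = sum_j (-1)^j p_(n+j) e_(k-j), as
    it is given on p_r and Newton's identity m(1,k) = (k+1) e_(k+1) carries it
    from the p_r to the e_k.  Extracting powers of u, the recurrence comes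
    down to
    - sum_(c < n) h_c m(n-c,k) = (n+k) s_(n,1^k) ([sum_h_mhook]), and
    - an evaluation of sum_c sum_j (-1)^j h_(c+j) m(n-c,k-j)
      ([sum_pairing_mgeo]).
    Both follow by induction from the Pieri-type rules
    h_n e_k = s_(n,1^k) + s_(n+1,1^(k-1)) and
    p_n e_k = m(n,k) + m(n+1,k-1). *)

(** * Coefficient extraction against a sequence *)

Section Pairing.
Variable A : comNzRingType.
Implicit Types (f : nat -> A) (c : A) (F G : {poly A}) (n : nat).

(** If F is a polynomial in 1/z, then [pairing f n F] is the coefficient of z^n
    in F * sum_m f_m z^m; for f = h this is how C_n uses the substituted
    function. *)
Definition pairing f (n : nat) F : A := \sum_(j < size F) F`_j * f (n + j)%N.

Lemma pairing_wide f n F d : (size F <= d)%N ->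
  pairing f n F = \sum_(j < d) F`_j * f (n + j)%N.
Proof.
move=> Fd; rewrite /pairing (big_ord_widen d (fun j => F`_j * f (n + j)%N)) //.
rewrite big_mkcond; apply: eq_bigr => j _.
by case: ltnP => // /(nth_default 0) ->; rewrite mul0r.
Qed.

Fact pairing_is_zmod_morphism f n : zmod_morphism (pairing f n).
Proof.
move=> F G; pose d := maxn (size F) (size G).
have sF : (size F <= d)%N by rewrite leq_maxl.
have sG : (size G <= d)%N by rewrite leq_maxr.
have sFG : (size ((F : {poly A}) - G)%R <= d)%N.
  by rewrite (leq_trans (size_polyD _ _)) // size_polyN.
rewrite (pairing_wide _ _ sF) (pairing_wide _ _ sG) (pairing_wide _ _ sFG).
by rewrite -sumrB; apply: eq_bigr => j _; rewrite coefB mulrBl.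
Qed.
HB.instance Definition _ f n :=
  GRing.isZmodMorphism.Build _ _ (pairing f n) (pairing_is_zmod_morphism f n).

Lemma pairingMC f n c F : pairing f n (c%:P * F) = c * pairing f n F.
Proof.
rewrite (@pairing_wide _ _ _ (size F)) ?mul_polyC ?size_scale_leq // mulr_sumr.
by apply: eq_bigr => j _; rewrite coefZ mulrA.
Qed.

Lemma pairingMX f n F : pairing f n ('X * F) = pairing f n.+1 F.
Proof.
rewrite mulrC (@pairing_wide _ _ _ (size F).+1); last first.
  by rewrite (leq_trans (size_polyMleq _ _)) // size_polyX addn2.
rewrite big_ord_recl coefMX /= mul0r add0r; apply: eq_bigr => j _.
by rewrite coefMX addSnnS.
Qed.

Lemma pairingMXn f n m F : pairing f n ('X^m * F) = pairing f (n + m) F.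
Proof.
elim: m n => [|m IH] n; first by rewrite mul1r addn0.
by rewrite exprS -mulrA pairingMX IH addSnnS.
Qed.

Lemma pairingC f n c : pairing f n c%:P = c * f n.
Proof.
by rewrite (@pairing_wide _ _ _ 1) ?size_polyC_leq1 // big_ord1 coefC addn0.
Qed.

(** In terms of generating series in t, the passage from F to [geosum F] is
    division by 1 + 'X t, i.e. [geosum F k] = sum_j (-'X)^j F_(k-j); the
    recursive form turns the identities below into inductions on k. *)
Fixpoint geosum (F : nat -> {poly A}) (k : nat) : {poly A} :=
  if k is k'.+1 then F k - 'X * geosum F k' else F 0%N.

Lemma geosumS (F : nat -> {poly A}) k :
  geosum F k.+1 = F k.+1 - 'X * geosum F k.
Proof. by []. Qed.

End Pairing.

(** * Hook functions and their convolution identities *)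

Section Hooks.
Variables (A : comNzRingType) (h e p : nat -> A).

(** With w for 'X, [egeo k] is e_k[X - w] and [eegeo k] is e_k[X - 2w]. *)
Definition egeo := geosum (fun k => (e k)%:P).
Definition eegeo := geosum egeo.
(** On symmetric functions and for n > 0, [hook n k], which is
    sum_j (-1)^j h_(n+j) e_(k-j), is the hook Schur function s_(n,1^k); with p
    in place of h, it becomes the sum of x_i^n e_k(other variables) over i. *)
Definition hook n k := pairing h n (egeo k).
Definition mhook n k := pairing p n (egeo k).
Definition mgeo n := geosum (fun k => (mhook n k)%:P).

Lemma hook_n0 n : hook n 0 = e 0%N * h n. Proof. exact: pairingC. Qed.
Lemma mhook_n0 n : mhook n 0 = e 0%N * p n. Proof. exact: pairingC. Qed.

Lemma hookS n k : hook n k.+1 = e k.+1 * h n - hook n.+1 k.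
Proof. by rewrite /hook /egeo geosumS raddfB /= pairingC pairingMX. Qed.

Lemma mhookS n k : mhook n k.+1 = e k.+1 * p n - mhook n.+1 k.
Proof. by rewrite /mhook /egeo geosumS raddfB /= pairingC pairingMX. Qed.

Lemma egeoS k : egeo k.+1 = (e k.+1)%:P - 'X * egeo k. Proof. by []. Qed.
Lemma eegeoS k : eegeo k.+1 = egeo k.+1 - 'X * eegeo k. Proof. by []. Qed.
Lemma mgeoS n k : mgeo n k.+1 = (mhook n k.+1)%:P - 'X * mgeo n k.
Proof. by []. Qed.

(** The rule p_n e_k = m(n,k) + m(n+1,k-1), with the t-series of both sides
    divided by 1 + 'X t. *)
Lemma mgeo_pieri n k : mgeo n k.+1 + mgeo n.+1 k = (p n)%:P * egeo k.+1.
Proof.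
have mE j : (mhook n j.+1)%:P = (e j.+1)%:P * (p n)%:P - (mhook n.+1 j)%:P.
  by rewrite mhookS polyCB polyCM.
elim: k => [|k IH].
  by rewrite mgeoS mE egeoS /mgeo /egeo /= !mhook_n0 !polyCM; ring.
rewrite mgeoS (mgeoS n.+1) mE.
transitivity ((e k.+2)%:P * (p n)%:P - 'X * (mgeo n k.+1 + mgeo n.+1 k)).
  by ring.
by rewrite IH (egeoS k.+1); ring.
Qed.

Lemma pairing_mgeoS c n k :
  pairing h c (mgeo n k.+1) = mhook n k.+1 * h c - pairing h c.+1 (mgeo n k).
Proof. by rewrite mgeoS raddfB /= pairingC pairingMX. Qed.

Lemma pairing_eegeoS n k :
  pairing h n (eegeo k.+1) = hook n k.+1 - pairing h n.+1 (eegeo k).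
Proof. by rewrite eegeoS raddfB /= pairingMX. Qed.

(* The complete, elementary and power sum functions satisfy these relations:
   hook0 says that sum_j (-1)^j h_j e_(k-j) = 0 for k > 0, and newton is
   Newton's identity (k+1) e_(k+1) = sum_j (-1)^j p_(1+j) e_(k-j). *)
Hypothesis h0 : h 0%N = 1.
Hypothesis e0 : e 0%N = 1.
Hypothesis hook0 : forall k, hook 0 k.+1 = 0.
Hypothesis newton : forall k, mhook 1 k = k.+1%:R * e k.+1.

Lemma hook1 k : hook 1 k = e k.+1.
Proof.
have /eqP := hook0 k.
by rewrite hookS h0 mulr1 subr_eq0 => /eqP.
Qed.

Lemma mgeo1 k : mgeo 1 k = 'X * eegeo k + k.+1%:R * egeo k.+1.
Proof.
elim: k => [|k IH].
  by rewrite egeoS /eegeo /mgeo /egeo /= newton e0; ring.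
by rewrite mgeoS newton IH eegeoS (egeoS k.+1) polyCM polyC_natr; ring.
Qed.

(** For k = 0 this is n h_n = sum_c h_c p_(n-c).  The Pieri-type rule
    expresses the sum for (n+1,k) by those for (n,0) and (n,k+1), so induction
    on n for all k at once needs only Newton's identity for e at n = 1. *)
Lemma sum_h_mhook n k :
  \sum_(0 <= c < n.+1) h c * mhook (n.+1 - c) k =
  (n.+1 + k)%:R * hook n.+1 k.
Proof.
elim: n k => [|n IH] k; first by rewrite big_nat1 h0 newton hook1; ring.
rewrite big_nat_recr //= subSnn newton.
have -> : \sum_(0 <= c < n.+1) h c * mhook (n.+2 - c) k =
    e k.+1 * (\sum_(0 <= c < n.+1) h c * mhook (n.+1 - c) 0) -
    \sum_(0 <= c < n.+1) h c * mhook (n.+1 - c) k.+1.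
  rewrite mulr_sumr -sumrB; apply: eq_big_nat => c /andP[_ cn].
  by rewrite mhookS mhook_n0 e0 -subSn 1?ltnW //; ring.
by rewrite !IH hook_n0 e0 hookS !natrD; ring.
Qed.

Lemma sum1_h_mhook n k :
  \sum_(1 <= c < n.+1) h c * mhook (n.+1 - c) k =
  (n.+1 + k)%:R * hook n.+1 k - mhook n.+1 k.
Proof. by rewrite -sum_h_mhook [in RHS]big_ltn // h0 subn0; ring. Qed.

(** On the level of generating series: m(n,-) has series E(t) times
    sum_j p_(n+j) (-t)^j, and pairing with h at 0 multiplies it by
    H(-t) = 1/E(t). *)
Lemma pairing0_mgeo n k : pairing h 0 (mgeo n k) = (-1) ^+ k * p (n + k)%N.
Proof.
elim: k n => [|k IH] n.
  by rewrite /mgeo /= pairingC mhook_n0 h0 e0 addn0; ring.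
have := congr1 (pairing h 0) (mgeo_pieri n k).
rewrite raddfD /= pairingMC [pairing h 0 (egeo _)]hook0 mulr0 IH addSnnS.
by move/eqP; rewrite addr_eq0 exprS => /eqP ->; ring.
Qed.

Lemma pairing1_eegeo k : pairing h 1 (eegeo k) = (-1) ^+ k * p k.+1.
Proof.
have := congr1 (pairing h 0) (mgeo1 k).
rewrite pairing0_mgeo raddfD /= pairingMX -polyC_natr pairingMC.
by rewrite [pairing h 0 (egeo _)]hook0 mulr0 addr0.
Qed.

(** The multiple of (k+1) (1 - 1/q) that the correction term (k+1) e_(n+k)
    contributes to the recurrence. *)
Definition hooksum n k :=
  \sum_(1 <= c < n) (-1) ^+ (n - c) * hook c (n - c + k).

Lemma hooksumS n k :
  hooksum n.+2 k = - (hooksum n.+1 k.+1 + hook n.+1 k.+1).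
Proof.
rewrite /hooksum big_nat_recr //= subSnn opprD; congr (_ + _); last by ring.
rewrite -sumrN; apply: eq_big_nat => c /andP[_ cn].
by rewrite (@subSn _ n.+1) 1?ltnW // exprS addSnnS; ring.
Qed.

(** Up to sign, p_N = sum_j (-1)^j s_(N-j,1^j) with N = n+k: [hooksum n k]
    holds the hooks with first part below n, and the pairing with [eegeo] the
    others. *)
Lemma hooksum_eegeo n k :
  hooksum n.+1 k + pairing h n.+1 (eegeo k) = (-1) ^+ k * p (n.+1 + k)%N.
Proof.
elim: n k => [|n IH] k.
  by rewrite /hooksum big_geq // add0r pairing1_eegeo.
have := IH k.+1; rewrite hooksumS pairing_eegeoS.
set x := pairing h _ _; rewrite exprS addnS => H.
transitivity (- (hooksum n.+1 k.+1 + (hook n.+1 k.+1 - x))); first by ring.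
by rewrite H; ring.
Qed.

(** The left-hand sides for (n, k+1) and (n+1, k) add up to known terms, by the
    recursion of [pairing h c (mgeo m k)] in c and k; so do the right-hand
    sides, by [hooksum_eegeo].  Hence induction on k for all n. *)
Lemma sum_pairing_mgeo n k :
  \sum_(1 <= c < n.+1) pairing h c (mgeo (n.+1 - c) k) =
  n%:R * pairing h n.+1 (eegeo k) - k.+1%:R * hooksum n.+1 k.
Proof.
elim: k n => [|k IH] n.
  have := hooksum_eegeo n 0; rewrite /eegeo /= [pairing _ _ _]hook_n0 => H.
  under eq_bigr do rewrite /mgeo /= pairingC mulrC.
  rewrite sum1_h_mhook mhook_n0 hook_n0.
  move: H; rewrite e0 expr0 addn0 !mul1r => <-.
  by ring.
have H1 := hooksum_eegeo n k.+1; rewrite pairing_eegeoS exprS in H1.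
have H2 := pairing0_mgeo n.+1 k.+1; rewrite pairing_mgeoS h0 mulr1 in H2.
have H3 := IH n.+1; rewrite big_ltn // big_add1 /= in H3.
rewrite subSS subn0 hooksumS in H3.
under eq_bigr do rewrite pairing_mgeoS mulrC.
rewrite sumrB sum1_h_mhook pairing_eegeoS.
move: H1 H2 H3; set w := pairing h 1 _; set z := pairing h n.+2 _.
set m := mhook _ _; set s := \sum_(1 <= c < n.+1) _.
rewrite exprS => H1 H2 H3.
have {}H3 := canRL (addKr _) H3.
have {}H2 := canRL (subrK _) H2.
by rewrite H3 H2 -H1 !natrD; ring.
Qed.

(** The truncation at c < n of the vanishing sum of (-1)^c h_c e_(N-c): the
    missing terms form a hook. *)
Lemma sum_alt_he n k :
  \sum_(0 <= c < n.+1) (-1) ^+ (n.+1 - c) * (h c * e (n.+1 - c + k)%N) =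
  - hook n.+1 k.
Proof.
elim: n k => [|n IH] k; first by rewrite big_nat1 h0 hook1 subn0; ring.
rewrite big_nat_recr //= subSnn.
have -> : \sum_(0 <= c < n.+1) (-1) ^+ (n.+2 - c) * (h c * e (n.+2 - c + k)%N) =
   - \sum_(0 <= c < n.+1) (-1) ^+ (n.+1 - c) * (h c * e (n.+1 - c + k.+1)%N).
  rewrite -sumrN; apply: eq_big_nat => c /andP[_ cn].
  by rewrite (@subSn _ n.+1) 1?ltnW // exprS addSnnS; ring.
by rewrite IH hookS; ring.
Qed.

Lemma sum1_alt_he n k :
  \sum_(1 <= c < n.+1) (-1) ^+ (n.+1 - c) * (h c * e (n.+1 - c + k)%N) =
  - hook n.+1 k - (-1) ^+ n.+1 * e (n.+1 + k)%N.
Proof. by rewrite -sum_alt_he [in RHS]big_ltn // h0 subn0; ring. Qed.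

(** ** The substitution X - (1 - v) w on hooks *)

(* phi stands for the plethystic substitution and v for 1/q; division by
   positive integers is what lets Newton's identity determine phi on the e_k. *)
Variables (v : A) (phi : {rmorphism A -> {poly A}}).
Hypothesis phi_p : forall r, (0 < r)%N ->
  phi (p r) = (p r)%:P - (1 - v ^+ r)%:P * 'X^r.
Hypothesis nat_inv : forall k, exists d : A, d * k.+1%:R = 1.

(** In generating series, phi multiplies E(t) by (1 + v t 'X) / (1 + t 'X)
    = v + (1 - v) / (1 + t 'X).  The formula for m(n,k) only uses the one for
    e_j with j <= k, and at n = 1 it yields the one for e_(k+1): this is why it
    is stated relative to such a hypothesis. *)
Lemma phi_mhook_of_e k n : (0 < n)%N ->
    (forall j, (j <= k)%N ->
       phi (e j) = v%:P * (e j)%:P + (1 - v)%:P * egeo j) ->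
  phi (mhook n k) = v%:P * (mhook n k)%:P + (1 - v)%:P * mgeo n k
    - 'X^n * (v%:P * egeo k + (1 - v)%:P * eegeo k)
    + (v ^+ n)%:P * 'X^n * egeo k.
Proof.
elim: k n => [|k IH] n n0 He.
  rewrite mhook_n0 e0 mul1r phi_p // /mgeo /eegeo /egeo /=.
  by rewrite mhook_n0 e0 mul1r !polyCB polyC1; ring.
have He1 := He k.+1 (leqnn _).
have Hm := IH n.+1 isT (fun j jk => He j (leqW jk)).
have -> : phi (mhook n k.+1) = phi (e k.+1) * phi (p n) - phi (mhook n.+1 k).
  by rewrite mhookS rmorphB rmorphM.
rewrite {}He1 {}Hm phi_p // mhookS.
have := canRL (addrK _) (mgeo_pieri n k) => ->.
rewrite eegeoS egeoS !polyCB !polyCM !rmorphXn /= polyC1 !exprS.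
by ring.
Qed.

Lemma phi_e k : phi (e k) = v%:P * (e k)%:P + (1 - v)%:P * egeo k.
Proof.
elim/ltn_ind: k => -[_|k IH].
  by rewrite /egeo /= e0 rmorph1 polyCB polyC1; ring.
have := phi_mhook_of_e (n := 1) isT IH; rewrite newton.
have [d dk] := nat_inv k.
have -> : phi (k.+1%:R * e k.+1) = k.+1%:R * phi (e k.+1).
  by rewrite rmorphM rmorph_nat.
rewrite mgeo1 => H.
have dk1 : d%:P * k.+1%:R = 1 :> {poly A} by rewrite -polyC_natr -polyCM dk.
rewrite -[LHS]mul1r -[RHS]mul1r -dk1 -!mulrA; congr (_ * _).
by rewrite H egeoS polyCM !polyCB polyC1 polyC_natr expr1; ring.
Qed.

Lemma pairing_phi_e c m :
  pairing h c (phi (e m)) = v * (h c * e m) + (1 - v) * hook c m.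
Proof.
rewrite phi_e (raddfD (pairing h c)) /= -polyCM pairingC pairingMC /hook.
by ring.
Qed.

Lemma pairing_phi_mhook c n k : (0 < n)%N ->
  pairing h c (phi (mhook n k)) =
  v * (h c * mhook n k) + (1 - v) * pairing h c (mgeo n k)
  - v * hook (c + n) k - (1 - v) * pairing h (c + n) (eegeo k)
  + v ^+ n * hook (c + n) k.
Proof.
move=> n0; rewrite phi_mhook_of_e //; last by move=> j _; exact: phi_e.
rewrite -mulrA -polyCM.
rewrite !(raddfD (pairing h c)) (raddfN (pairing h c)) /= pairingC.
rewrite pairingMXn (raddfD (pairing h _)) /= !pairingMC pairingMXn /hook.
by ring.
Qed.

(** Up to the factor - (- v)^n, the solution of the second recurrence. *)
Definition mhook_corr n k := mhook n k + (-1) ^+ n * (k.+1%:R * e (n + k)%N).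

(** The second recurrence.  The powers of v above the first only come from the
    last term of [pairing_phi_mhook], and they form the sum on the right.  The
    rest is affine in v: the part in v is [sum_h_mhook] and [sum_alt_he], the
    part in 1 - v is [sum_pairing_mgeo] and cancels. *)
Lemma sum_pairing_mhook_corr n k :
  \sum_(1 <= c < n.+1) pairing h c (phi (mhook_corr (n.+1 - c) k)) =
  (\sum_(1 <= i < n.+1) v ^+ i) * hook n.+1 k - v * mhook_corr n.+1 k.
Proof.
set x := hook n.+1 k; set z := pairing h n.+1 (eegeo k).
have phiE c : (1 <= c < n.+1)%N -> pairing h c (phi (mhook_corr (n.+1 - c) k)) =
    v * (h c * mhook (n.+1 - c) k) + (1 - v) * pairing h c (mgeo (n.+1 - c) k)
    + v ^+ (n.+1 - c) * x - (v * x + (1 - v) * z)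
    + k.+1%:R * v * ((-1) ^+ (n.+1 - c) * (h c * e (n.+1 - c + k)%N))
    + k.+1%:R * (1 - v) * ((-1) ^+ (n.+1 - c) * hook c (n.+1 - c + k)).
  case/andP=> c1 cn; rewrite /mhook_corr rmorphD rmorphM rmorphXn rmorphN1 /=.
  rewrite rmorphM rmorph_nat raddfD /= pairing_phi_mhook ?subn_gt0 //.
  rewrite subnKC 1?ltnW // -/x -/z.
  have -> : (-1) ^+ (n.+1 - c) * (k.+1%:R * phi (e (n.+1 - c + k)%N)) =
     ((-1) ^+ (n.+1 - c) * k.+1%:R)%:P * phi (e (n.+1 - c + k)%N).
    by rewrite polyCM rmorphXn rmorphN1 polyC_natr mulrA.
  by rewrite pairingMC pairing_phi_e; ring.
rewrite (eq_big_nat _ _ phiE) !big_split /= -!mulr_sumr.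
rewrite sumr_const_nat subSS subn0 sum_pairing_mgeo -/z -/(hooksum _ _).
have rev : \sum_(1 <= c < n.+1) v ^+ (n.+1 - c) * x =
    (\sum_(1 <= i < n.+1) v ^+ i) * x.
  by rewrite mulr_suml big_nat_rev; apply: eq_big_nat => c /andP[c1 cn];
     rewrite add1n subSS subnA ?subnn // ltnW.
rewrite rev sum1_h_mhook sum1_alt_he -/x /mhook_corr.
by rewrite -mulr_natl !natrD; ring.
Qed.

End Hooks.

(** * Coefficients of hook functions *)

Section SymmetricFunctions.
Variable R : comNzRingType.
Local Notation Sym := (symfun R).
Implicit Types (f : Sym) (s : seq nat).

Definition sf_elementary k : Sym := 'm_(nseq k 1%N).
Local Notation elem := sf_elementary.

Definition nnz s := count (ltn 0) s.

Lemma nnz_sumn s : (nnz s <= sumn s)%N.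
Proof. by elim: s => //= -[|a] s IH //=; rewrite leq_add. Qed.

Lemma nnz_gt0 s : (0 < nnz s)%N = (0 < sumn s)%N.
Proof. by elim: s => //= -[|a] s IH. Qed.

Lemma sf_coefM_cons f g j s :
  (f * g) (j :: s) = (\sum_(i < j.+1) sf_cons i f * sf_cons (j - i) g) s.
Proof. by rewrite sf_coef_sum. Qed.

Lemma sf_mono_nil a (lam : seq nat) : ('m_(a :: lam) : Sym) [::] = 0.
Proof. by rewrite /=; case: (boolP (perm_eq _ _)) => // /perm_size. Qed.

Lemma sf_cons_mono j (lam : seq nat) : (0 < j)%N ->
  sf_cons j 'm_lam = if j \in lam then 'm_(rem j lam) else 0 :> Sym.
Proof.
move=> j0; apply: symfun_eq => s /=; rewrite j0; case: ifP => jlam.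
  by rewrite (permPr (perm_to_rem jlam)) perm_cons.
case: (boolP (perm_eq _ _)) => // /perm_mem /(_ j).
by rewrite jlam mem_head.
Qed.

Lemma sf_cons_p j r : sf_cons j.+1 'p_r = (j.+1 == r)%:R :> Sym.
Proof.
rewrite sf_cons_mono // inE; case: eqP => [->|_] //=; rewrite eqxx.
apply: symfun_eq => s /=; rewrite /series_one; congr (nat_of_bool _)%:R.
by elim: s => [|[|a] s IH] //=; apply/negP => /perm_size.
Qed.

Lemma sf_elementary0 : elem 0 = 1.
Proof.
apply: symfun_eq => s /=; rewrite /series_one; congr (nat_of_bool _)%:R.
by elim: s => [|[|a] s IH] //=; apply/negP => /perm_size.
Qed.

Lemma sf_complete0 : 'h_0 = 1 :> Sym.
Proof.
apply: symfun_eq => s /=; rewrite /series_one; congr (nat_of_bool _)%:R.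
by elim: s => [|[|a] s IH].
Qed.

Lemma sf_cons_e j k :
  sf_cons j.+1 (elem k) = if (j == 0)%N && (0 < k)%N then elem k.-1 else 0.
Proof.
rewrite sf_cons_mono //; case: k => [|k]; first by rewrite in_nil andbF.
by rewrite mem_nseq; case: j.
Qed.

Lemma sf_coefMe0 f k s : (f * elem k) (0%N :: s) = (f * elem k) s.
Proof. by rewrite sf_coefM_cons big_ord1 !sf_cons0. Qed.

Lemma sf_coefMe f k j s :
  (f * elem k.+1) (j.+1 :: s) =
  (sf_cons j.+1 f * elem k.+1) s + (sf_cons j f * elem k) s.
Proof.
rewrite sf_coefM_cons -sf_coefD; congr (sfcoef _ s).
rewrite 2!big_ord_recr /= subnn sf_cons0 subSnn sf_cons_e /=.
rewrite big1 ?add0r 1?addrC // => i _.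
rewrite subSn 1?ltnW // sf_cons_e subn_eq0 leqNgt ltn_ord /=.
by rewrite mulr0.
Qed.

(** A monomial of degree c + k arises from h_c e_k once for each choice of k of
    the variables occurring in it. *)
Lemma sf_coef_he c k s :
  ('h_c * elem k) s = ((sumn s == (c + k)%N)%:R * 'C(nnz s, k)%:R).
Proof.
elim: s c k => [|j s IH] c k.
  rewrite /= /series_one /sf_elementary /=.
  by case: c k => [|c] [|k]; rewrite ?mulr0 ?mul0r ?bin0 // mul1r.
case: k => [|k].
  by rewrite sf_elementary0 mulr1 addn0 bin0 mulr1.
case: j => [|j]; first by rewrite sf_coefMe0 IH.
have hcons i m : (sf_cons i 'h_c * elem m) s =
    (((i + sumn s)%N == (c + m)%N)%:R * 'C(nnz s, m)%:R).
  have [ic|ci] := leqP i c.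
    have -> : sf_cons i 'h_c = 'h_(c - i) :> Sym.
      apply: symfun_eq => t /=; congr (nat_of_bool _)%:R.
      by rewrite -(eqn_add2l i (sumn t)) subnKC.
    by rewrite IH -(eqn_add2l i) addnA subnKC.
  have -> : sf_cons i 'h_c = 0 :> Sym.
    by apply: symfun_eq => t /=; rewrite gtn_eqF // ltn_addr.
  rewrite mul0r; case: eqP => [E|_]; last by rewrite mul0r.
  rewrite bin_small ?mulr0 //; apply: leq_ltn_trans (nnz_sumn s) _.
  by rewrite -(ltn_add2l i) E ltn_add2r.
rewrite sf_coefMe !hcons [sumn _]/= [nnz _]/= binS natrD mulrDr.
by rewrite addSn addnS eqSS.
Qed.

Local Notation hook := (hook (sf_complete R) sf_elementary).
Local Notation mhook := (mhook sf_elementary (sf_powersum R)).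

(** Alternating sums of binomial coefficients telescope by Pascal's rule. *)
Lemma sf_coef_hook c k s :
  hook c k s = ((sumn s == (c + k)%N)%:R * 'C((nnz s).-1, k)%:R).
Proof.
elim: k c => [|k IH] c.
  by rewrite hook_n0 sf_elementary0 mul1r bin0 mulr1 addn0.
rewrite hookS sf_coefD sf_coefN IH mulrC sf_coef_he -addSnnS.
have := nnz_gt0 s; case: (nnz s) => [|l] /esym ls.
  have -> : sumn s = 0%N by apply/eqP; rewrite eqn0Ngt ls.
  by rewrite addSn !mul0r subr0.
by rewrite binS natrD mulrDr addrK.
Qed.

(** A monomial of degree k+1 has at most k+1 variables, so the binomial
    coefficient of [sf_coef_hook] vanishes. *)
Lemma hook_0S k : hook 0 k.+1 = 0.
Proof.
apply: symfun_eq => s; rewrite sf_coef_hook add0n.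
have [E|] := eqP; last by rewrite mul0r.
rewrite mul1r bin_small // prednK ?nnz_gt0 ?E //.
by rewrite -[X in (_ <= X)%N]E nnz_sumn.
Qed.

(** The monomial form of [mhook n k]: the factor k+1 at n = 1 counts the choices
    of the variable x_i among those of a monomial of e_(k+1). *)
Definition augmented_hook n k : Sym :=
  if n == 1%N then k.+1%:R *: elem k.+1 else 'm_(n :: nseq k 1%N).

Lemma sf_cons_augmented_hook n k j : (0 < n)%N ->
  sf_cons j.+1 (augmented_hook n k) = (j.+1 == n)%:R * elem k
    + (if (j == 0)%N && (0 < k)%N then augmented_hook n k.-1 else 0).
Proof.
rewrite /augmented_hook; case: eqP => [->|/eqP n1] n0.
  have consZ c f : sf_cons j.+1 (c *: f) = c *: sf_cons j.+1 f.
    exact: symfun_eq.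
  rewrite consZ sf_cons_e andbT eqSS; case: eqP => _ /=; last first.
    by rewrite scaler0 mul0r add0r.
  rewrite mul1r; case: k => [|k] /=; first by rewrite scale1r addr0.
  by rewrite -[X in X + _]scale1r -scalerDl nat1r.
rewrite sf_cons_mono // inE mem_nseq eqSS /= (eq_sym n).
case: (j.+1 =P n) => [jn|_] /=.
  have -> : (j == 0)%N = false by apply: contraNF n1 => /eqP j0; rewrite -jn j0.
  by rewrite mul1r addr0.
by rewrite mul0r add0r andbC; case: j k => [|j] [|k].
Qed.

Lemma pieri_p0 n : (0 < n)%N -> 'p_n * elem 0 = augmented_hook n 0.
Proof.
rewrite sf_elementary0 mulr1 /augmented_hook; case: eqP => [->|//] _.
by rewrite scale1r.
Qed.

(** Both sides satisfy the same recursion when the exponent of the first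
    variable is split off, so the coefficients agree by induction on the
    monomial. *)
Lemma pieri_pS n k : (0 < n)%N ->
  'p_n * elem k.+1 = augmented_hook n k.+1 + augmented_hook n.+1 k.
Proof.
move=> n0; apply: symfun_eq => s; elim: s k => [|[|j] s IH] k.
- have augmented_nil m i : augmented_hook m i [::] = 0.
    rewrite /augmented_hook /sf_elementary.
    case: ifP => _; last exact: sf_mono_nil.
    by rewrite sf_coefZ sf_mono_nil mulr0.
  rewrite sf_coefD !augmented_nil addr0 [LHS]/=.
  by rewrite [X in X * _]sf_mono_nil mul0r.
- by rewrite sf_coefMe0 IH -{1}[augmented_hook n k.+1 + _]sf_cons0.
have consp : (sf_cons j 'p_n * elem k) s =
    ((j == n)%:R * elem k + (if j == 0%N then
       augmented_hook n k + (if (0 < k)%N then augmented_hook n.+1 k.-1 else 0)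
     else 0)) s.
  case: (posnP j) => [->|].
    rewrite sf_cons0 (ltn_eqF n0) mul0r add0r.
    by case: k => [|k]; [rewrite pieri_p0 ?addr0 | exact: IH].
  by case: j => // j _; rewrite sf_cons_p addr0.
rewrite sf_coefMe sf_cons_p consp -sf_coefD.
transitivity ((sf_cons j.+1 (augmented_hook n k.+1)
             + sf_cons j.+1 (augmented_hook n.+1 k)) s) => //.
congr (sfcoef _ s); rewrite !sf_cons_augmented_hook // andbT eqSS.
case: (j == 0%N) => /=; last by rewrite !addr0.
by rewrite [RHS]addrACA !addrA.
Qed.

Lemma mhook_augmented n k : (0 < n)%N -> mhook n k = augmented_hook n k.
Proof.
elim: k n => [|k IH] n n0; first by rewrite mhook_n0 mulrC pieri_p0.
by rewrite mhookS mulrC pieri_pS // IH // addrK.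
Qed.

Lemma newton_e k : mhook 1 k = k.+1%:R * elem k.+1.
Proof.
by rewrite mhook_augmented // /augmented_hook eqxx scaler_nat mulr_natl.
Qed.

Lemma mhook_monomial n k : (1 < n)%N -> mhook n k = 'm_(n :: nseq k 1%N).
Proof.
move=> n1; rewrite (mhook_augmented _ (ltnW n1)).
by rewrite /augmented_hook (gtn_eqF n1).
Qed.

End SymmetricFunctions.

(** * Sums of the operators over compositions *)

Section Specialization.
Local Notation h := (sf_complete Qq).
Local Notation e := (sf_elementary Qq).
Local Notation p := (sf_powersum Qq).
Local Notation hook := (hook h e).
Local Notation mhook := (mhook e p).
Local Notation u := (q^-1 : Qq).

Lemma q_neq0 : q != 0.
Proof. by rewrite /q tofrac_eq0 polyX_eq0. Qed.

Lemma Qq_natr_neq0 n : n.+1%:R != 0 :> Qq.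
Proof.
rewrite -(rmorph_nat (@tofrac {poly rat})) tofrac_eq0 -polyC_natr polyC_eq0.
by rewrite Num.Theory.pnatr_eq0.
Qed.

Lemma CopE a P : Cop a.+1 P = (- u) ^+ a *: pairing h a.+1 (pleth P).
Proof. by rewrite /Cop -addn1 PoszD addrK. Qed.

Fact Cop_linear a : linear (Cop a).
Proof.
move=> c P Q.
have plethZ : pleth (c *: P) = (c%:A)%:P * pleth P.
  by rewrite -(plethP.1 c) -rmorphM mulr_algl.
rewrite /Cop -![\sum_(j < _) _]/(pairing h a _) rmorphD /= plethZ.
rewrite raddfD /= pairingMC mulr_algl scalerDr !scalerA.
by rewrite [c * _]mulrC.
Qed.
HB.instance Definition _ a :=
  GRing.isLinear.Build Qq Lambda Lambda _ (Cop a) (Cop_linear a).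

Lemma CopZ a c P : Cop a (c *: P) = c *: Cop a P.
Proof. exact: linearZ. Qed.

Fact Ccomp_linear tau : linear (Ccomp tau).
Proof.
move=> c P Q; elim: tau => //= a tau IH.
by rewrite /Ccomp /= -!/(Ccomp _ _) IH linearP.
Qed.
HB.instance Definition _ tau :=
  GRing.isLinear.Build Qq Lambda Lambda _ (Ccomp tau) (Ccomp_linear tau).

Definition compsum N (P : Lambda) : Lambda :=
  \sum_(tau <- compositions N) Ccomp tau P.

Fact compsum_linear N : linear (compsum N).
Proof.
move=> c P Q; rewrite /compsum scaler_sumr -big_split /=.
by apply: eq_bigr => tau _; rewrite linearP.
Qed.
HB.instance Definition _ N :=
  GRing.isLinear.Build Qq Lambda Lambda _ (compsum N) (compsum_linear N).

Lemma compsumZ N c P : compsum N (c *: P) = c *: compsum N P.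
Proof. exact: linearZ. Qed.

Lemma compositions_rec_fuel f g n : (n <= f)%N -> (n <= g)%N ->
  compositions_rec f n = compositions_rec g n.
Proof.
elim: f g n => [|f IH] [|g] [|n] // nf ng.
change (flatten [seq [seq a :: t | t <- compositions_rec f (n.+1 - a)]
                | a <- iota 1 n.+1]
      = flatten [seq [seq a :: t | t <- compositions_rec g (n.+1 - a)]
                | a <- iota 1 n.+1]).
congr flatten; apply/eq_in_map => a; rewrite mem_iota => /andP[a1 _].
have na : (n.+1 - a <= n)%N by rewrite leq_subLR -addn1 addnC leq_add2r.
by rewrite (IH g) ?(leq_trans na).
Qed.

Lemma compsum0 P : compsum 0 P = P.
Proof. exact: big_seq1. Qed.

Lemma compsumS N P :
  compsum N.+1 P = \sum_(1 <= c < N.+2) Cop c (compsum (N.+1 - c) P).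
Proof.
rewrite /compsum.
change (compositions N.+1) with
  [seq a :: t | a <- iota 1 N.+1, t <- compositions_rec N (N.+1 - a)].
rewrite big_allpairs_dep /index_iota subSS subn0.
rewrite big_seq [RHS]big_seq; apply: eq_bigr => a.
rewrite mem_iota => /andP[a1 _]; rewrite linear_sum.
rewrite (@compositions_rec_fuel N (N.+1 - a)) //.
by rewrite leq_subLR -addn1 addnC leq_add2r.
Qed.

(** Unfolding the recurrence gives one term for each a and each way of writing
    n - a as a sum of parts c; the inductive step exchanges the sums over the
    first part c and over a. *)
Lemma compsum_solve (G b : nat -> Lambda) :
  (forall n, G n.+1 = b n.+1 + \sum_(1 <= c < n.+1) Cop c (G (n.+1 - c)%N)) ->
  forall n, G n.+1 = \sum_(1 <= a < n.+2) compsum (n.+1 - a) (b a).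
Proof.
move=> HG; elim/ltn_ind => n IH.
rewrite HG [RHS]big_nat_recr //= subnn compsum0 addrC; congr (_ + _).
pose T a c := Cop c (compsum (n.+1 - a - c) (b a)).
transitivity (\sum_(1 <= c < n.+1)
    \sum_(1 <= a < n.+1 | (a < (n.+1 - c).+1)%N) T a c).
  apply: eq_big_nat => c /andP[c1 cn].
  have nc : (n.+1 - c = (n - c).+1)%N by rewrite subSn.
  rewrite nc IH; last by rewrite ltn_subrL c1 (leq_trans c1).
  rewrite linear_sum -nc -(big_nat_widen _ _ _ xpredT); last by lia.
  by apply: eq_big_nat => a _; rewrite /T subnAC.
rewrite (exchange_big_dep_nat xpredT) //=.
apply: eq_big_nat => a /andP[a1 an].
have na : (n.+1 - a = (n - a).+1)%N by rewrite subSn.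
rewrite na compsumS [RHS](big_nat_widen _ _ n.+1) -na; last by lia.
rewrite big_nat_cond [RHS]big_nat_cond; apply: eq_big => [c|c _] //.
by apply/idP/idP; lia.
Qed.

Lemma pleth_p r : (0 < r)%N ->
  pleth (p r) = (p r)%:P - (1 - (u%:A) ^+ r)%:P * 'X^r.
Proof.
move=> r0; rewrite plethP.2 // mul_polyC.
by rewrite exprZn expr1n exprVn scalerBl scale1r.
Qed.

Lemma natr_Lambda_inv k : exists d : Lambda, d * k.+1%:R = 1.
Proof.
exists (k.+1%:R^-1)%:A; rewrite mulr_algl -scaler_nat scalerA.
by rewrite mulVf ?scale1r ?Qq_natr_neq0.
Qed.

Let e0 : e 0 = 1 := sf_elementary0 _.
Let h0 : h 0 = 1 := sf_complete0 _.
Let hook0 := @hook_0S Qq.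
Let newton := @newton_e Qq.

Lemma Cop_e c m :
  Cop c.+1 (e m) = (- u) ^+ c *: (u *: (h c.+1 * e m) + (1 - u) *: hook c.+1 m).
Proof.
rewrite CopE (pairing_phi_e h e0 newton pleth_p natr_Lambda_inv).
by rewrite mulrBl mul1r !mulr_algl [in RHS]scalerBl scale1r.
Qed.

(** C_(a+1) e_(k+1) involves h e and a hook with weights u and 1 - u; adding -u
    times the next hook turns the first into a hook as well. *)
Lemma sum_Cop_e a k :
  \sum_(0 <= b < k.+1) Cop (a.+1 + b) (e (k - b)) = (- u) ^+ a *: hook a.+1 k.
Proof.
elim: k a => [|k IH] a.
  rewrite big_nat1 addn0 Cop_e hook_n0 e0 mulr1 mul1r.
  by rewrite -scalerDl addrC subrK scale1r.
rewrite big_nat_recl // addn0 subn0.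
under eq_bigr do rewrite subSS -addSnnS.
rewrite IH Cop_e exprS [_ * (_ ^+ a)]mulrC -scalerA -scalerDr.
congr (_ *: _); rewrite hookS [h _ * _]mulrC scaleNr scalerBl scale1r scalerBr.
ring.
Qed.

Lemma sum_compsum_1 m : compsum m 1 = e m.
Proof.
elim/ltn_ind: m => -[_|m IH]; first by rewrite compsum0 e0.
rewrite compsumS -(hook1 h0 hook0) -[RHS]scale1r -(expr0 (- u)) -sum_Cop_e.
rewrite big_add1; apply: eq_big_nat => c /andP[_ cm].
by rewrite subSS IH ?ltnS ?leq_subr // add1n.
Qed.

Lemma compsum_nested N a k :
  \sum_(tau <- compositions N) \sum_(0 <= b < k.+1)
    \sum_(rho <- compositions (k - b))
      Ccomp tau (Cop (a.+1 + b) (Ccomp rho 1)) =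
  compsum N ((- u) ^+ a *: hook a.+1 k).
Proof.
rewrite -sum_Cop_e; apply: eq_bigr => tau _.
rewrite (linear_sum (Ccomp tau)); apply: eq_bigr => b _.
by rewrite -sum_compsum_1 (linear_sum (Cop _)) (linear_sum (Ccomp tau)).
Qed.

Local Notation kappa n := (\sum_(1 <= i < n) u ^+ i).
Local Notation mhook_corr := (mhook_corr e p).

(** The recurrence is the sum for e_(n+k) over the first part c, cut into c < n
    and c >= n. *)
Lemma elementary_expansion n k :
  e (n.+1 + k) =
  \sum_(1 <= a < n.+2) compsum (n.+1 - a) ((- u) ^+ a.-1 *: hook a k).
Proof.
pose G n := e (n + k); rewrite -/(G n.+1); apply: compsum_solve => {}n.
rewrite /G /= -sum_Cop_e addSn -(hook1 h0 hook0) -[LHS]scale1r -(expr0 (- u)).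
rewrite -sum_Cop_e (@big_cat_nat _ _ _ n) //=; last by lia.
rewrite addrC -{1}(add0n n) big_addn; congr (_ + _).
  rewrite (_ : (_ - n)%N = k.+1); last by lia.
  by apply: eq_bigr => b _; congr (Cop _ (e _)); lia.
rewrite big_add1; apply: eq_big_nat => c cn.
by congr (Cop _ (e _)); lia.
Qed.

Lemma mhook_corr_expansion n k :
  - ((- u) ^+ n.+1 *: mhook_corr n.+1 k) =
  \sum_(1 <= a < n.+2)
     compsum (n.+1 - a) (kappa a *: ((- u) ^+ a.-1 *: hook a k)).
Proof.
pose G n := - (- u) ^+ n *: mhook_corr n k.
rewrite -scaleNr -/(G n.+1); apply: compsum_solve => {}n.
have CG c : (1 <= c < n.+1)%N -> Cop c (G (n.+1 - c)%N) =
    - (- u) ^+ n *: pairing h c (pleth (mhook_corr (n.+1 - c) k)).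
  case: c => // c cn; rewrite /G CopZ CopE scalerA mulNr -exprD.
  by congr (- _ ^+ _ *: _); lia.
rewrite (eq_big_nat _ _ CG) -scaler_sumr.
rewrite (sum_pairing_mhook_corr h0 e0 hook0 newton pleth_p natr_Lambda_inv).
have -> : \sum_(1 <= i < n.+1) (u%:A : Lambda) ^+ i = (kappa n.+1)%:A.
  by rewrite scaler_suml; apply: eq_bigr => i _; rewrite exprZn expr1n.
rewrite !mulr_algl scalerBr !scalerA /= [kappa _ * _]mulrC mulNr scaleNr.
rewrite addrA subrr sub0r -scaleNr /G exprS.
by congr (_ *: _); rewrite !mulNr !opprK mulrC.
Qed.

End Specialization.

(** * The monomial expansion *)

Theorem theorem4p1 (n k : nat) (hn : (2 <= n)%N) (hk : (1 <= k)%N) :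
  (-1) ^+ (n - 1) *: 'm_(n :: nseq k 1%N) =
  \sum_(1 <= a < n.+1)
    ((k.+1)%:R + \sum_(1 <= i < a) q ^+ (n - i)) *:
      (\sum_(tau <- compositions (n - a))
        \sum_(0 <= b < k.+1)
          \sum_(rho <- compositions (k - b))
            Ccomp tau (Cop (a + b) (Ccomp rho 1))) :> Lambda.
Proof.
case: n hn => // n hn.
have inner a : (1 <= a < n.+2)%N ->
  ((k.+1)%:R + \sum_(1 <= i < a) q ^+ (n.+1 - i)) *:
      (\sum_(tau <- compositions (n.+1 - a))
        \sum_(0 <= b < k.+1)
          \sum_(rho <- compositions (k - b))
            Ccomp tau (Cop (a + b) (Ccomp rho 1))) =
  k.+1%:R *: compsum (n.+1 - a)
     ((- q^-1) ^+ a.-1 *: hook (sf_complete Qq) (sf_elementary Qq) a k) +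
  q ^+ n.+1 *: compsum (n.+1 - a) ((\sum_(1 <= i < a) q^-1 ^+ i) *:
     ((- q^-1) ^+ a.-1 *: hook (sf_complete Qq) (sf_elementary Qq) a k)).
  case: a => // a an.
  rewrite compsum_nested (compsumZ _ (\sum_(1 <= i < a.+1) q^-1 ^+ i)).
  rewrite [in RHS]scalerA -scalerDl; congr (_ *: _).
  congr (_ + _); rewrite mulr_sumr; apply: eq_big_nat => i ia.
  rewrite -[in RHS](@subnK i n.+1); last by lia.
  by rewrite exprD -mulrA -exprMn mulfV ?q_neq0 // expr1n mulr1.
rewrite (eq_big_nat _ _ inner) big_split /= -!scaler_sumr.
rewrite -elementary_expansion -mhook_corr_expansion /mhook_corr.
rewrite scalerN scalerA -exprMn mulrN mulfV ?q_neq0 // mhook_monomial //.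
rewrite scalerDr subn1 /= exprS mulN1r scaleNr opprD opprK.
have -> : (-1) ^+ n.+1 * (k.+1%:R * sf_elementary Qq (n.+1 + k)) =
    (-1) ^+ n.+1 *: (k.+1%:R *: sf_elementary Qq (n.+1 + k)).
  rewrite -signr_odd -[in RHS]signr_odd mulr_sign scaler_sign.
  by rewrite scaler_nat mulr_natl.
have sign : - (-1) ^+ n * (-1) ^+ n.+1 = 1 :> Qq.
  by rewrite exprS mulrA mulrN1 opprK -expr2 sqrr_sign.
by rewrite [_ *: (_ *: (_ *: _))]scalerA sign scale1r addrCA subrr addr0.
Qed.
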